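(* In the setting described in the context, let $\phi_l$ be the $l$-th conjugate gradient (CG) solution, with zero initial guess, of $\min_{\phi\in H_{\overline{G}}}\|T\phi-\mathbf{f}\|_2^2$, i.e. $$\phi_l=\operatorname*{arg\,min}_{\phi\in\mathcal{H}_l}\|T\phi-\mathbf{f}\|_2,\qquad \mathcal{H}_l:=\mathrm{span}\{(T^*T)^iT^*\mathbf{f}\}_{i=0}^{l-1}.$$ Let $\pi$ be the linear operator $$\pi:\mathbb{R}^{n_0J}\to H_0:=\mathrm{span}\{\xi_{kj}\}_{1\le k\le n_0,1\le j\le J}\subset H_{\overline{G}},\qquad \mathbf{c}=(c_{kj})\mapsto\sum_{k,j}c_{kj}\xi_{kj}.$$ Then $\phi_l=\pi(\mathbf{c}_l)=\sum_{k,j}\mathbf{c}_l(kj)\,\xi_{kj}$ with $$\mathbf{c}_l=\operatorname*{arg\,min}_{\mathbf{c}\in\mathcal{K}_l}\|\boldsymbol{\Sigma}\mathbf{c}-\mathbf{f}\|_2,\qquad \mathcal{K}_l:=\mathrm{span}\{\boldsymbol{\Sigma}^i\boldsymbol{\Sigma}^\dagger\mathbf{f}\}_{i=1}^{l},$$ and $\mathcal{H}_l=\pi(\mathcal{K}_l)=\mathrm{span}\{\sum_{k,j}\mathbf{a}_i(kj)\,\xi_{kj}\}_{i=1}^l$, where $\mathbf{a}_i=\boldsymbol{\Sigma}^i\boldsymbol{\Sigma}^\dagger\mathbf{f}$. In particular, $T\phi=\boldsymbol{\Sigma}\mathbf{c}$ for any $\phi=\sum_{k,j}c_{kj}\xi_{kj}+\xi$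 with $\xi\in H_0^\perp$ (orthogonal complement in $H_{\overline{G}}$) and $\mathbf{c}=(c_{kj})\in\mathbb{R}^{n_0J}$; moreover $$T\circ\pi=\boldsymbol{\Sigma},\qquad T^*=\pi\circ(\boldsymbol{\Sigma}^\dagger\boldsymbol{\Sigma}).$$
   Context: Setting. $\mathcal{S}=[0,1]$ with Lebesgue measure; $\mathcal{X}=\{x_j\}_{j=1}^J\subset[0,1]$ is a uniform mesh with mesh size $1/J$, equipped with the atomic measure $\nu(\{x_j\})=1/J$. For given inputs $u_1,\dots,u_{n_0}$ the real-valued functions $g[u_k](x,s)$, $(x,s)\in\mathcal{X}\times\mathcal{S}$, lie in $L^2(\mathcal{X}\times\mathcal{S})$ and are uniformly bounded. $\mathbf{f}=(f_k(x_j))\in\mathbb{R}^{n_0J}$ is the vector of output data. Exploration measure. $\rho$ is the measure on $\mathcal{S}$ with Lebesgue density $\dot\rho(s)=\frac{1}{n_0Z}\sum_{k=1}^{n_0}\int_{\mathcal{X}}|g[u_k](x,s)|\,\nu(dx)$, where $Z=\frac1{n_0}\sum_{k=1}^{n_0}\int_{\mathcal{S}}\int_{\mathcal{X}}|g[u_k](x,s)|\,\nu(dx)\,ds$ (assumed positive). $L^2_\rho=L^2_\rho(\mathcal{S})$. Automatic reproducing kernel and its RKHS. $G(s,s')=\frac1{n_0}\sum_{k=1}^{n_0}\int_{\mathcal{X}}g[u_k](x,s)g[u_k](x,s')\,\nu(dx)$ and $\overline{G}(s,s')=\frac{G(s,s')}{\dot\rho(s)\dot\rho(s')}\mathbf{1}_{\{\dot\rho(s)\dot\rho(s')>0\}}$.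 The operator $\mathcal{L}_{\overline{G}}:L^2_\rho\to L^2_\rho$, $\mathcal{L}_{\overline{G}}\phi(s)=\int_{\mathcal{S}}\phi(s')\overline{G}(s,s')\rho(ds')$, is compact, self-adjoint and positive semidefinite. $H_{\overline{G}}=\mathcal{L}_{\overline{G}}^{1/2}(L^2_\rho)$ is the RKHS of $\overline{G}$ with inner product $\langle\phi,\psi\rangle_{H_{\overline{G}}}=\langle\mathcal{L}_{\overline{G}}^{-1/2}\phi,\mathcal{L}_{\overline{G}}^{-1/2}\psi\rangle_{L^2_\rho}$, where $\mathcal{L}_{\overline{G}}^{-1/2}$ is the inverse of $\mathcal{L}_{\overline{G}}^{1/2}$ restricted to $\mathcal{N}(\mathcal{L}_{\overline{G}})^\perp$. Automatic basis functions. $\xi_{kj}(s)=\int_{\mathcal{S}}\overline{G}(s,s')\,g[u_k](x_j,s')\,ds'$, which belong to $H_{\overline{G}}$; $\boldsymbol{\Sigma}=(\langle\xi_{kj},\xi_{k'j'}\rangle_{H_{\overline{G}}})\in\mathbb{R}^{n_0J\times n_0J}$. Operator $T$. $T:H_{\overline{G}}\to(\mathbb{R}^{n_0J},\langle\cdot,\cdot\rangle_2)$, $T\phi=(\langle\xi_{kj},\phi\rangle_{H_{\overline{G}}})_{k,j}$; $T^*$ is its Hilbert space adjoint. Conventions. $\dagger$ denotes the Moore–Penrose pseudoinverse; $l\ge1$ is an integer; vectors in $\mathbb{R}^{n_0J}$ are indexed by pairs $(k,j)$, with $\mathbf{c}(kj)$ the $(k,j)$ component. *)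

(* Defs.v *)
From HB Require Import structures.
From mathcomp Require Import all_boot all_order all_algebra.
From mathcomp Require Import all_classical all_reals all_analysis.
From mathcomp Require Import measurable_realfun.
Set Implicit Arguments.
Unset Strict Implicit.
Unset Printing Implicit Defensive.
Import Order.TTheory GRing.Theory Num.Theory.
Import numFieldNormedType.Exports.
Local Open Scope classical_set_scope.
Local Open Scope ring_scope.

Section L2space.
Context d (T : measurableType d) (R : realType).
Variable mu : {measure set T -> \bar R}.

Definition ae_zero : {pred LfunType mu (lee1n 2)} :=
  [pred f : LfunType mu (lee1n 2) | `[< f = 0 %[ae mu] >]].

Lemma ae_zero_submod_closed : submod_closed ae_zero.
Proof.
split; first by apply/asboolP; apply: nearW => x.
move=> a f g /asboolP f0 /asboolP g0; apply/asboolP.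
near=> x => _.
have fx : f x = 0 by apply: (near f0 x).
have gx : g x = 0 by apply: (near g0 x).
rewrite -[LHS]/(a * f x + g x) fx gx mulr0 addr0.
by [].
Unshelve. all: by end_near. Qed.

HB.instance Definition _ :=
  GRing.isZmodClosed.Build _ ae_zero (GRing.submod_closedB ae_zero_submod_closed).

(* The library's LspaceType carries no vector-space structure, so L^2(mu) is
   the quotient of the module of square-integrable functions by the submodule
   of the almost everywhere null ones. *)
Definition L2 := Quotient.quot ae_zero.

HB.instance Definition _ := GRing.Zmodule.on L2.

Local Open Scope quotient_scope.

Definition L2_scale (a : R) (u : L2) : L2 := \pi_L2 (a *: repr u).

Lemma L2_piP (f g : LfunType mu (lee1n 2)) :
  reflect (\pi_L2 f = \pi_L2 g) (f - g \in ae_zero).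
Proof. by rewrite Quotient.idealrBE; exact: eqP. Qed.

Lemma pi_L2_scale a (f : LfunType mu (lee1n 2)) :
  L2_scale a (\pi_L2 f) = \pi_L2 (a *: f).
Proof.
apply/L2_piP; rewrite -scalerBr.
have h : repr (\pi_L2 f) - f \in ae_zero by apply/L2_piP; rewrite reprK.
have [_ cl] := ae_zero_submod_closed.
rewrite -[a *: _]addr0; apply: cl => //.
by case: ae_zero_submod_closed.
Qed.

Lemma pi_L2_add (f g : LfunType mu (lee1n 2)) :
  \pi_L2 (f + g) = \pi_L2 f + \pi_L2 g :> L2.
Proof. exact: (@Quotient.pi_add _ ae_zero). Qed.

Fact L2_scaleA a b (v : L2) : L2_scale a (L2_scale b v) = L2_scale (a * b) v.
Proof.
elim/quotW: v => f.
by rewrite (pi_L2_scale b f) (pi_L2_scale a (b *: f)) pi_L2_scale scalerA.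
Qed.

Fact L2_scale1 : left_id 1 L2_scale.
Proof. by elim/quotW => f; rewrite pi_L2_scale scale1r. Qed.

Fact L2_scaleDr : right_distributive L2_scale +%R.
Proof.
move=> a; elim/quotW => f; elim/quotW => g.
by rewrite -pi_L2_add (pi_L2_scale a (f + g)) (pi_L2_scale a f)
  (pi_L2_scale a g) scalerDr pi_L2_add.
Qed.

Fact L2_scaleDl (v : L2) : {morph L2_scale^~ v : a b / a + b}.
Proof.
elim/quotW: v => f a b.
by rewrite (pi_L2_scale _ f) (pi_L2_scale a f) (pi_L2_scale b f) scalerDl
  pi_L2_add.
Qed.

HB.instance Definition _ := GRing.Zmodule_isLmodule.Build R L2
  L2_scaleA L2_scale1 L2_scaleDr L2_scaleDl.

(* Class of a real function; the zero class if the function is not in L^2. *)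
Definition L2_class (f : T -> R) : L2 := \pi_L2 (insubd 0 f).

Definition L2_rep (u : L2) : T -> R := repr u.

Definition L2_dot (u v : L2) : R := \int[mu]_t (L2_rep u t * L2_rep v t).

End L2space.

Section Density.
Variable R : realType.

Definition density_fun (f : R -> R) (_ : measurable_fun setT f)
    (_ : forall s, 0 <= f s) : set (measurableTypeR R) -> \bar R :=
  fun A => (\int[lebesgue_measure]_(s in A) (f s)%:E)%E.

Section instance.
Variables (f : R -> R) (mf : measurable_fun setT f) (f0 : forall s, 0 <= f s).

Let density0 : density_fun mf f0 set0 = 0%E.
Proof. by rewrite /density_fun integral_set0. Qed.

Let density_ge0 A : (0 <= density_fun mf f0 A)%E.
Proof. by apply: integral_ge0 => s _; rewrite lee_fin. Qed.

Let density_sigma_additive : semi_sigma_additive (density_fun mf f0).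
Proof.
move=> /= F mF tF mUF; rewrite /density_fun; apply: cvg_toP.
  apply: ereal_nondecreasing_is_cvgn => m n mn.
  apply: lee_sum_nneg_natr => // k _ _.
  by apply: integral_ge0 => /= x Fkx; rewrite lee_fin.
rewrite ge0_integral_bigcup//=.
- by apply/measurable_EFinP; exact: measurable_funTS.
- by move=> x _; rewrite lee_fin.
Qed.

HB.instance Definition _ := isMeasure.Build _ _ _ (density_fun mf f0)
  density0 density_ge0 density_sigma_additive.

End instance.

(* The measure with Lebesgue density f, for f measurable and nonnegative (the
   zero measure otherwise). *)
Definition density_measure (f : R -> R) :
    {measure set (measurableTypeR R) -> \bar R} :=
  match pselect (measurable_fun setT f /\ forall s, 0 <= f s) with
  | left h => density_fun h.1 h.2
  | right _ => mzero
  end.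

End Density.

Section LinearAlgebra.
Variable R : realType.

Definition lin_span (V : lmodType R) (I : finType) (w : I -> V) : set V :=
  [set v | exists a : I -> R, v = \sum_i a i *: w i].

Definition argmin (V : Type) (D : set V) (F : V -> R) : set V :=
  [set v | D v /\ forall w, D w -> F v <= F w].

Definition dot2 n (u v : 'cV[R]_n) : R := \sum_i u i 0 * v i 0.

(* The library's norm on matrices is the sup norm. *)
Definition norm2 n (v : 'cV[R]_n) : R := Num.sqrt (dot2 v v).

(* The library's pinvmx is a generalized inverse without the two symmetry
   conditions. *)
Definition is_moore_penrose m n (A : 'M[R]_(m, n)) (B : 'M[R]_(n, m)) : Prop :=
  [/\ A *m B *m A = A, B *m A *m B = B,
      (A *m B)^T = A *m B & (B *m A)^T = B *m A].

Definition mp_inv m n (A : 'M[R]_(m, n)) : 'M[R]_(n, m) :=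
  xget 0 [set B | is_moore_penrose A B].

(* The inverse of mxvec_index: the pair (k, j) encoded by i. *)
Definition kj m n (i : 'I_(m * n)) : 'I_m * 'I_n :=
  enum_val (cast_ord (esym (mxvec_cast m n)) i).

Lemma mxvec_indexK m n (k : 'I_m) (j : 'I_n) : kj (mxvec_index k j) = (k, j).
Proof. by rewrite /kj /mxvec_index cast_ordK enum_rankK. Qed.

End LinearAlgebra.

Section OperatorSqrt.
Context d (T : measurableType d) (R : realType).
Variable mu : {measure set T -> \bar R}.
Implicit Types (A L : L2 mu -> L2 mu).

Definition is_positive_sqrt L A : Prop :=
  [/\ linear A,
      forall u v, L2_dot (A u) v = L2_dot u (A v),
      forall u, 0 <= L2_dot (A u) u &
      forall u, A (A u) = L u].

Definition op_sqrt L : L2 mu -> L2 mu := xget (cst 0) (is_positive_sqrt L).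

Definition op_kernel L : set (L2 mu) := [set u | L u = 0].

Definition L2_orth (D : set (L2 mu)) : set (L2 mu) :=
  [set u | forall v, D v -> L2_dot u v = 0].

(* The inverse of L^(1/2) restricted to the orthogonal complement of the kernel
   of L. *)
Definition op_inv_sqrt L (phi : L2 mu) : L2 mu :=
  xget 0 [set u | L2_orth (op_kernel L) u /\ op_sqrt L u = phi].

End OperatorSqrt.

(* g k y s stands for g[u_k](y, s); only y in the mesh x and s in [0, 1]
   matter. *)
Section Setting.
Variables (R : realType) (n0 J : nat).
Variables (x : 'I_J -> R) (g : 'I_n0 -> R -> R -> R).

Local Notation leb := (@lebesgue_measure R).
Local Notation S := (`[0, 1]%classic : set R).

Definition uniform_mesh : Prop :=
  (forall j, x j \in `[0, 1]) /\
  forall j j' : 'I_J, x j' - x j = (j'%:R - j%:R) / J%:R.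

(* The integral against the measure giving mass 1/J to each mesh point. *)
Definition mesh_int (h : R -> R) : R := J%:R^-1 * \sum_(j < J) h (x j).

Definition square_integrable_XS (h : R -> R -> R) : Prop :=
  (forall j, measurable_fun S (h (x j))) /\
  (\int[leb]_(s in S) (mesh_int (fun y => h y s ^+ 2))%:E < +oo)%E.

Definition uniformly_bounded : Prop :=
  exists C : R, forall k j s, s \in `[0, 1] -> `|g k (x j) s| <= C.

Definition Znorm : R :=
  n0%:R^-1 * \sum_(k < n0) \int[leb]_(s in S) mesh_int (fun y => `|g k y s|).

Definition rhodot (s : R) : R :=
  (n0%:R * Znorm)^-1 * \sum_(k < n0) mesh_int (fun y => `|g k y s|).

(* A measure on the line, concentrated on [0, 1]. *)
Definition rho : {measure set (measurableTypeR R) -> \bar R} :=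
  density_measure (rhodot \_ S).

Definition G (s s' : R) : R :=
  n0%:R^-1 * \sum_(k < n0) mesh_int (fun y => g k y s * g k y s').

Definition Gbar (s s' : R) : R :=
  if 0 < rhodot s * rhodot s' then G s s' / (rhodot s * rhodot s') else 0.

(* Functions on [0, 1] are extended by 0 to the line. *)
Definition class_rho (f : R -> R) : L2 rho := L2_class rho (f \_ S).

Definition LG (phi : L2 rho) : L2 rho :=
  class_rho (fun s => \int[rho]_(s' in S) (L2_rep phi s' * Gbar s s')).

Definition HG : set (L2 rho) := range (op_sqrt LG).

Definition HG_dot (phi psi : L2 rho) : R :=
  L2_dot (op_inv_sqrt LG phi) (op_inv_sqrt LG psi).

Definition xi_kj (k : 'I_n0) (j : 'I_J) : L2 rho :=
  class_rho (fun s => \int[leb]_(s' in S) (Gbar s s' * g k (x j) s')).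

Definition Sigma : 'M[R]_(n0 * J) :=
  \matrix_(i, i') HG_dot (xi_kj (kj i).1 (kj i).2) (xi_kj (kj i').1 (kj i').2).

(* T and its adjoint are meaningful on HG only. *)
Definition Top (phi : L2 rho) : 'cV[R]_(n0 * J) :=
  \col_i HG_dot (xi_kj (kj i).1 (kj i).2) phi.

Definition Tadj (c : 'cV[R]_(n0 * J)) : L2 rho :=
  xget 0 [set psi | HG psi /\
                    forall phi, HG phi -> dot2 (Top phi) c = HG_dot phi psi].

Definition xi_comb (c : 'cV[R]_(n0 * J)) : L2 rho :=
  \sum_(k < n0) \sum_(j < J) c (mxvec_index k j) 0 *: xi_kj k j.

Definition H0 : set (L2 rho) := lin_span (fun p : 'I_n0 * 'I_J => xi_kj p.1 p.2).

Definition H0_orth : set (L2 rho) :=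
  [set psi | HG psi /\ forall eta, H0 eta -> HG_dot psi eta = 0].

Definition data_vec (f : 'I_n0 -> R -> R) : 'cV[R]_(n0 * J) :=
  \col_i f (kj i).1 (x (kj i).2).

Definition Hl (b : 'cV[R]_(n0 * J)) (l : nat) : set (L2 rho) :=
  lin_span (fun i : 'I_l => iter i (Tadj \o Top) (Tadj b)).

Definition krylov_vec (b : 'cV[R]_(n0 * J)) (i : nat) : 'cV[R]_(n0 * J) :=
  Sigma ^+ i *m (mp_inv Sigma *m b).

Definition Kl (b : 'cV[R]_(n0 * J)) (l : nat) : set 'cV[R]_(n0 * J) :=
  lin_span (fun i : 'I_l => krylov_vec b i.+1).

End Setting.

Arguments LG {R n0 J} x g phi.
Arguments HG_dot {R n0 J} x g phi psi.
Arguments Top {R n0 J} x g phi.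
Arguments HG {R n0 J} x g _.
Arguments H0 {R n0 J} x g _.
Arguments H0_orth {R n0 J} x g _.
Arguments Hl {R n0 J} x g b l _.

(* Main.v *)
From HB Require Import structures.
Require Import Defs.
From mathcomp Require Import all_boot all_order all_algebra.
From mathcomp Require Import all_classical all_reals all_analysis.
From mathcomp Require Import measurable_realfun.
From mathcomp Require Import ring.
From mathcomp.real_closed Require Import complex.
Set Implicit Arguments.
Unset Strict Implicit.
Unset Printing Implicit Defensive.
Import Order.TTheory GRing.Theory Num.Theory.
Import numFieldNormedType.Exports.
Local Open Scope classical_set_scope.
Local Open Scope ring_scope.

(** The mesh and the set of inputs being finite, the integral operator has finite
    rank. With [N = n0 * J] and [h_i = g_i / rhodot], where [g_i] runs through the
    functions [g[u_k](x_j, .)], one has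
    [L phi = 1/N * \sum_i <h_i, phi> h_i] in [L2 rho] ([LG_finite_rank]), and a
    change of measure gives [xi_i = L h_i] ([xi_kjE]). Here the [h_i] are bounded
    because [rhodot] is a multiple of the sum of the absolute values of the [g_i].

    A positive square root of such an operator is found from the Gram matrix [M]
    of the [h_i]: it is a multiple of [\sum_ij (M^(-1/2))_ij <h_j, phi> h_i], with
    the power taken to be zero on the kernel of [M] ([finite_rank_sqrt_exists]).
    The matrix power is a polynomial in [M], which the complex spectral theorem
    provides ([symmetric_spectrum], [psd_inv_sqrt]).

    The inner product of [H_G] then satisfies [<L u, phi>_H = <u, phi>] for [phi] in
    [H_G] ([rkhs_dot_op]). So [T] samples [phi] at the [h_i],
    [<pi c, phi>_H = c . T phi], and therefore [T pi = Sigma] and [T^* = pi]. The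
    square norm of [pi c] is [c . Sigma c], hence [pi] vanishes on the kernel of
    [Sigma], and [T^* = pi (Sigma^+ Sigma)].

    It follows that [(T^* T)^i T^* b = pi (Sigma^i b)], and modulo the kernel of
    [Sigma] the vector [Sigma^i b] is [Sigma^(i+1) Sigma^+ b] ([linear_krylov]):
    this is [H_l = pi K_l]. The two residuals agree because [T pi = Sigma]. The
    minimizer on [K_l] exists by orthogonal projection and is unique because
    [K_l] lies in the range of [Sigma], on which a symmetric matrix is injective
    ([residual_argmin]); its image under [pi] is the minimizer on [H_l]. *)

(** * Real matrices *)

Section RealMatrices.
Variable R : realType.

Lemma dot2E n (u v : 'cV[R]_n) : dot2 u v = (u^T *m v) 0 0.
Proof. by rewrite mxE; apply: eq_bigr => i _; rewrite mxE. Qed.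

Lemma dot2C n (u v : 'cV[R]_n) : dot2 u v = dot2 v u.
Proof. by apply: eq_bigr => i _; rewrite mulrC. Qed.

Lemma dot2Dl n (u v w : 'cV[R]_n) : dot2 (u + v) w = dot2 u w + dot2 v w.
Proof. by rewrite !dot2E linearD mulmxDl mxE. Qed.

Lemma dot2Dr n (u v w : 'cV[R]_n) : dot2 w (u + v) = dot2 w u + dot2 w v.
Proof. by rewrite dot2C dot2Dl !(dot2C w). Qed.

Lemma dot2Br n (u v w : 'cV[R]_n) : dot2 w (u - v) = dot2 w u - dot2 w v.
Proof. by rewrite !dot2E mulmxBr !mxE. Qed.

Lemma dot20r n (u : 'cV[R]_n) : dot2 u 0 = 0.
Proof. by rewrite dot2E mulmx0 mxE. Qed.

Lemma dot2_mulmx m n (A : 'M[R]_(m, n)) u v :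
  dot2 (A *m u) v = dot2 u (A^T *m v).
Proof. by rewrite !dot2E trmx_mul mulmxA. Qed.

Lemma dot2_ge0 n (u : 'cV[R]_n) : 0 <= dot2 u u.
Proof. by apply: sumr_ge0 => i _; rewrite -expr2 sqr_ge0. Qed.

Lemma dot2_eq0 n (u : 'cV[R]_n) : dot2 u u = 0 -> u = 0.
Proof.
move=> /eqP; rewrite psumr_eq0 => [/allP u0|i _]; last first.
  by rewrite -expr2 sqr_ge0.
apply/matrixP => i j; rewrite mxE ord1.
have /eqP := u0 i (mem_index_enum _); rewrite -expr2 => /eqP.
by rewrite sqrf_eq0 => /eqP.
Qed.

(** The square norm of [A *m u] is the inner product of [u] with
    [A^T *m A *m u]. *)
Lemma mulmx_trmx_eq0 m n (A : 'M[R]_(m, n)) (u : 'cV[R]_n) :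
  A^T *m (A *m u) = 0 -> A *m u = 0.
Proof.
by move=> AAu; apply: dot2_eq0; rewrite dot2_mulmx AAu dot20r.
Qed.

Lemma row_full_gram_unit m n (A : 'M[R]_(m, n)) :
  row_full A -> A^T *m A \in unitmx.
Proof.
move=> /row_fullP[B BA]; rewrite -unitmx_tr -row_free_unit -kermx_eq0.
apply/eqP/row_matrixP => i; rewrite row0; apply: trmx_inj; rewrite trmx0.
set k := row _ _.
have kA : k *m (A^T *m A)^T = 0 by rewrite /k -row_mul mulmx_ker row0.
have : A^T *m (A *m k^T) = 0.
  by apply: trmx_inj; rewrite mulmxA trmx_mul trmxK kA trmx0.
move=> /mulmx_trmx_eq0 Ak.
by rewrite -[k^T]mul1mx -BA -mulmxA Ak mulmx0.
Qed.

(** From a full-rank factorization [A = C *m B], with [C] injective and [B]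
    surjective, the inverses of the Gram matrices of [C] and of [B^T] give
    [B^T (B B^T)^-1 (C^T C)^-1 C^T]. *)
Lemma moore_penrose_exists m n (A : 'M[R]_(m, n)) :
  exists B, is_moore_penrose A B.
Proof.
have [r [C [B [Cfull Bfree ->]]]] : exists r (C : 'M[R]_(m, r)) (B : 'M[R]_(r, n)),
    [/\ row_full C, row_free B & A = C *m B].
  exists (\rank A), (col_base A), (row_base A).
  by split; [exact: col_base_full|exact: row_base_free|rewrite mulmx_base].
have Cu : C^T *m C \in unitmx by exact: row_full_gram_unit.
have Bu : B *m B^T \in unitmx.
  rewrite -[X in X *m _]trmxK; apply: row_full_gram_unit.
  by rewrite /row_full mxrank_tr.
pose X := invmx (C^T *m C) *m C^T; pose Y := B^T *m invmx (B *m B^T).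
have XC : X *m C = 1%:M by rewrite /X -mulmxA mulVmx.
have BY : B *m Y = 1%:M by rewrite /Y mulmxA mulmxV.
have CXt : (C *m X)^T = C *m X.
  by rewrite /X mulmxA !trmx_mul trmxK trmx_inv trmx_mul trmxK mulmxA.
have YBt : (Y *m B)^T = Y *m B.
  by rewrite /Y !trmx_mul trmxK trmx_inv trmx_mul trmxK mulmxA.
clearbody X Y; exists (Y *m X); split.
- by rewrite !mulmxA -(mulmxA C B Y) BY mulmx1 -(mulmxA C X C) XC mulmx1.
- by rewrite !mulmxA -(mulmxA Y X C) XC mulmx1 -(mulmxA Y B Y) BY mulmx1.
- by rewrite mulmxA -(mulmxA C B Y) BY mulmx1.
- by rewrite mulmxA -(mulmxA Y X C) XC mulmx1.
Qed.

Lemma mp_invP m n (A : 'M[R]_(m, n)) : is_moore_penrose A (mp_inv A).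
Proof.
by have [B AB] := moore_penrose_exists A; exact: (xgetPex 0 (ex_intro _ B AB)).
Qed.

(** [A A^+] is the orthogonal projection onto the range of [A], so this is
    Pythagoras' identity. *)
Lemma least_squares m n (A : 'M[R]_(m, n)) (b : 'cV[R]_m) (u : 'cV[R]_n) :
  let r := A *m (mp_inv A *m b) in
  dot2 (A *m u - b) (A *m u - b)
    = dot2 (A *m u - r) (A *m u - r) + dot2 (r - b) (r - b).
Proof.
move=> r; have [AXA _ AXt _] := mp_invP A.
have orth : A^T *m (r - b) = 0.
  apply: trmx_inj; rewrite trmx0 trmx_mul trmxK linearB /= /r mulmxA trmx_mul.
  by rewrite AXt mulmxBl -mulmxA AXA subrr.
rewrite -[A *m u - b](subrKA r).
have -> : A *m u - r = A *m (u - mp_inv A *m b) by rewrite mulmxBr.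
move: (r - b) (u - _) orth => e d Ae.
rewrite dot2Dl !dot2Dr (dot2C e (A *m d)) (dot2_mulmx A d e) Ae.
by rewrite dot20r addr0 add0r.
Qed.

(** * Functional calculus of real symmetric matrices *)

Lemma poly_interpolation (K : fieldType) (s : seq K) (f : K -> K) :
  exists q : {poly K}, {in s, forall x, q.[x] = f x}.
Proof.
elim: s => [|x s [q qf]]; first by exists 0.
have [xs|xs] := boolP (x \in s).
  by exists q => y; rewrite inE => /predU1P[->|]; exact: qf.
pose p := \prod_(y <- s) ('X - y%:P).
have px : p.[x] != 0.
  by rewrite -[_ == _]/(root p x) root_prod_XsubC.
exists (q + ((f x - q.[x]) / p.[x]) *: p) => y; rewrite inE !hornerE.
move=> /predU1P[->|ys]; first by rewrite divfK// subrKC.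
by have /rootP -> : root p y; [rewrite root_prod_XsubC|rewrite mulr0 addr0 qf].
Qed.

Local Notation toC := (real_complex R).

(** Over the complex numbers the matrix is unitarily diagonalizable with real
    eigenvalues, so a polynomial that vanishes at these eigenvalues annihilates
    it. This turns identities between functions of [M] into identities between
    numbers. *)
Lemma symmetric_spectrum n (M : 'M[R]_n.+1) : M^T = M ->
  exists2 s : seq R, {in s, forall a, eigenvalue M a} &
    forall p : {poly R}, {in s, forall a, p.[a] = 0} -> horner_mx M p = 0.
Proof.
move=> Msym; pose MC := map_mx toC M.
have MCherm : MC \is hermsymmx.
  apply/is_hermitianmxP; rewrite expr0 scale1r realmxC //.
    by rewrite map_trmx Msym.
  by apply/mxOverP => i j; rewrite !mxE; apply/complex_realP; exists (M j i).
have /orthomx_spectralP := hermitian_normalmx MCherm.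
have /mxOverP spR := hermitian_spectral_diag_real MCherm.
have Punit := spectral_unit MC.
set P := spectralmx MC in Punit *; set sp := spectral_diag MC in spR * => MCE.
have /choice[lam spE] i : exists a, sp 0 i = toC a by exact/complex_realP.
exists [seq lam i | i <- enum 'I_n.+1] => [a /mapP[i _ ->]|p p0].
  (* The characteristic polynomial is real, so its real complex roots are
     eigenvalues of [M] itself. *)
  suff: root (char_poly MC) (sp 0 i).
    by rewrite spE -map_char_poly fmorph_root -eigenvalue_root_char.
  rewrite -eigenvalue_root_char; apply/eigenvalueP; exists (row i P).
    rewrite -/MC MCE -row_mul mulmxA mulmxA mulmxV // mul1mx row_mul.
    by rewrite row_diag_mx -scalemxAl -rowE.
  apply: contraTneq Punit => Pi0; rewrite -row_free_unit.
  by apply/row_freePn; exists i; rewrite Pi0 sub0mx.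
apply: (map_mx_inj (f := toC)); rewrite map_horner_mx map_mx0 -/MC MCE.
rewrite horner_mx_uconjC // horner_mx_diag.
suff -> : map_mx (horner (map_poly toC p)) sp = 0.
  by rewrite linear0 mulmx0 mul0mx.
apply/matrixP => i j; rewrite !mxE ord1 spE horner_map p0 ?rmorph0 //.
by apply/mapP; exists j => //; rewrite mem_enum.
Qed.

Lemma trmx_horner_mx n (M : 'M[R]_n.+1) p :
  M^T = M -> (horner_mx M p)^T = horner_mx M p.
Proof.
move=> Msym; elim/poly_ind: p => [|p c IH]; first by rewrite rmorph0 trmx0.
rewrite rmorphD rmorphM /= horner_mx_X horner_mx_C linearD /= tr_scalar_mx.
by rewrite -mulmxE trmx_mul IH Msym; congr (_ + _); apply/esym/comm_horner_mx.
Qed.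

(** The power [-1/2] of a positive semidefinite symmetric matrix, taken to be
    zero on the kernel. It is built as the square of a symmetric power [-1/4],
    which makes it positive semidefinite. *)
Lemma psd_inv_sqrt n (M : 'M[R]_n) : M^T = M ->
  (forall u : 'cV[R]_n, 0 <= dot2 u (M *m u)) ->
  exists r : 'M[R]_n, [/\ r^T = r, r *m M = M *m r,
    forall u : 'cV[R]_n, 0 <= dot2 u (r *m u) & r *m r *m M *m M = M].
Proof.
case: n M => [M|n M] Msym Mpsd.
  by exists 0; split => [| | u|]; rewrite ?thinmx0 ?flatmx0 // [leRHS]big_ord0.
have [s s_eig s_ann] := symmetric_spectrum Msym.
have s_ge0 : {in s, forall a, 0 <= a}.
  move=> a /s_eig /eigenvalueP[v vM v0].
  have vTM : M *m v^T = a *: v^T by rewrite -{1}Msym -trmx_mul vM linearZ.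
  have := Mpsd v^T; rewrite vTM dot2E -scalemxAr mxE -dot2E pmulr_lge0 //.
  rewrite lt_neqAle dot2_ge0 andbT eq_sym; apply: contra v0.
  by move=> /eqP/dot2_eq0/(congr1 trmx); rewrite trmxK trmx0 => ->.
have [q qs] := poly_interpolation s (fun a => (Num.sqrt (Num.sqrt a))^-1).
pose t := horner_mx M q.
have tsym : t^T = t by exact: trmx_horner_mx.
have tM : t *m M = M *m t by apply: comm_horner_mx.
exists (t *m t); split.
- by rewrite trmx_mul tsym.
- by rewrite -mulmxA tM !mulmxA tM.
- by move=> u; rewrite -mulmxA dot2C dot2_mulmx tsym dot2_ge0.
- apply/eqP; rewrite -subr_eq0 !mulmxE.
  have := s_ann (q * q * (q * q) * 'X * 'X - 'X) _.
  rewrite !(rmorphB, rmorphM) /= horner_mx_X => -> // a sa.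
  (* The identity at an eigenvalue [a] is [a^-1 * a^2 = a] unless [a = 0], where
     both sides vanish. *)
  rewrite !hornerE qs //.
  have := s_ge0 a sa; rewrite le_eqVlt => /predU1P[<-|a_gt0].
    by rewrite !mulr0 subr0.
  set x := Num.sqrt (Num.sqrt a).
  have xE : x ^+ 4 = a.
    by rewrite (exprM _ 2 2) !sqr_sqrtr ?sqrtr_ge0 // ltW.
  have x0 : x != 0 by rewrite /x gt_eqF // !sqrtr_gt0.
  by clearbody x; rewrite -xE /=; field.
Qed.

End RealMatrices.

(** * The inner product of square-integrable classes *)

Section L2InnerProduct.
Context d (T : measurableType d) (R : realType).
Variable mu : {measure set T -> \bar R}.
Local Open Scope quotient_scope.
Local Notation dot := (@L2_dot d T R mu).
Local Notation Lf := (LfunType mu (lee1n 2)).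

Lemma pi_L2_0 : \pi_(L2 mu) 0 = 0 :> L2 mu.
Proof.
rewrite -(scale0r (0 : Lf)) -pi_L2_scale.
by rewrite -[LHS]/(0 *: (\pi_(L2 mu) 0 : L2 mu)) scale0r.
Qed.

Lemma L2_rep_pi (f : Lf) : L2_rep (\pi_(L2 mu) f) = f %[ae mu].
Proof.
have : repr (\pi_(L2 mu) f) - f \in @ae_zero _ _ _ mu by apply/L2_piP; rewrite reprK.
move=> /asboolP; apply: filterS => t /(_ I) /= ft _.
by apply/eqP; rewrite -subr_eq0; apply/eqP.
Qed.

Lemma L2_rep_Lfun2 (u : L2 mu) : L2_rep u \in Lfun mu 2%:E.
Proof. exact: LfunP. Qed.

Lemma Lfun2_measurable (f : T -> R) : f \in Lfun mu 2%:E -> measurable_fun setT f.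
Proof. by move=> /sub_Lfun_mfun; rewrite inE. Qed.

Lemma Lfun2_integrableM (f g : T -> R) : f \in Lfun mu 2%:E -> g \in Lfun mu 2%:E ->
  mu.-integrable setT (EFin \o (fun t => f t * g t)).
Proof. by move=> f2 g2; apply/Lfun1_integrable; exact: Lfun2_mul_Lfun1. Qed.

Lemma Rintegral_ae_eq (f g : T -> R) :
  measurable_fun setT f -> measurable_fun setT g -> f = g %[ae mu] ->
  \int[mu]_t f t = \int[mu]_t g t.
Proof.
move=> mf mg fg; congr fine; apply: ae_eq_integral => //.
- exact/measurable_EFinP.
- exact/measurable_EFinP.
- by apply: filterS fg => t /(_ I) /= ->.
Qed.

Lemma L2_dot_pi (f g : Lf) :
  dot (\pi_(L2 mu) f) (\pi_(L2 mu) g) = \int[mu]_t (f t * g t).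
Proof.
apply: Rintegral_ae_eq.
- by apply: measurable_funM; exact: Lfun2_measurable (LfunP _).
- by apply: measurable_funM; exact: Lfun2_measurable (LfunP _).
- by apply: filterS2 (L2_rep_pi f) (L2_rep_pi g) => t /(_ I) + /(_ I) + _ => -> ->.
Qed.

Lemma L2_dot_class (f : T -> R) (u : L2 mu) : f \in Lfun mu 2%:E ->
  dot u (L2_class mu f) = \int[mu]_t (L2_rep u t * f t).
Proof.
move=> f2; rewrite -[u in LHS]reprK L2_dot_pi.
by apply: eq_Rintegral => t _; rewrite /insubd insubT.
Qed.

Lemma L2_dot_classes (f f' : T -> R) : f \in Lfun mu 2%:E -> f' \in Lfun mu 2%:E ->
  dot (L2_class mu f) (L2_class mu f') = \int[mu]_t (f t * f' t).
Proof.
move=> f2 f2'; rewrite L2_dot_pi.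
by apply: eq_Rintegral => t _; rewrite /insubd !insubT.
Qed.

Lemma L2_dotC (u v : L2 mu) : dot u v = dot v u.
Proof. by apply: eq_Rintegral => t _; rewrite mulrC. Qed.

Lemma L2_dotDl (u v w : L2 mu) : dot (u + v) w = dot u w + dot v w.
Proof.
rewrite -[u]reprK -[v]reprK -[w]reprK -pi_L2_add !L2_dot_pi -RintegralD //;
  try (apply: Lfun2_integrableM; exact: LfunP).
by apply: eq_Rintegral => t _; rewrite /= mulrDl.
Qed.

Lemma L2_dotZl a (u v : L2 mu) : dot (a *: u) v = a * dot u v.
Proof.
rewrite -[u]reprK -[v]reprK.
rewrite -[_ *: _]/(L2_scale a _) pi_L2_scale !L2_dot_pi -RintegralZl //;
  last by apply: Lfun2_integrableM; exact: LfunP.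
by apply: eq_Rintegral => t _; rewrite /= mulrA.
Qed.

Lemma L2_dotDr (u v w : L2 mu) : dot w (u + v) = dot w u + dot w v.
Proof. by rewrite L2_dotC L2_dotDl !(L2_dotC w). Qed.

Lemma L2_dotZr a (u v : L2 mu) : dot v (a *: u) = a * dot v u.
Proof. by rewrite L2_dotC L2_dotZl L2_dotC. Qed.

Lemma L2_dot0l (v : L2 mu) : dot 0 v = 0.
Proof. by rewrite -(scale0r 0) L2_dotZl mul0r. Qed.

Lemma L2_dotBl (u v w : L2 mu) : dot (u - v) w = dot u w - dot v w.
Proof. by rewrite L2_dotDl -scaleN1r L2_dotZl mulN1r. Qed.

Lemma L2_dotBr (u v w : L2 mu) : dot w (u - v) = dot w u - dot w v.
Proof. by rewrite L2_dotC L2_dotBl !(L2_dotC w). Qed.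

Lemma L2_dot_suml (I : finType) (F : I -> L2 mu) v :
  dot (\sum_i F i) v = \sum_i dot (F i) v.
Proof.
apply: (big_morph (fun u => dot u v)) => [x y|]; first exact: L2_dotDl.
exact: L2_dot0l.
Qed.

Lemma L2_dot_ge0 (u : L2 mu) : 0 <= dot u u.
Proof. by apply: Rintegral_ge0 => t _; rewrite -expr2 sqr_ge0. Qed.

Lemma L2_dot_eq0 (u : L2 mu) : dot u u = 0 -> u = 0.
Proof.
move=> uu0; have mu2 := Lfun2_integrableM (L2_rep_Lfun2 u) (L2_rep_Lfun2 u).
have int0 : (\int[mu]_t `|(L2_rep u t * L2_rep u t)%:E| = 0)%E.
  rewrite -[RHS]/(0%:E) -uu0 fineK; last exact: integrable_fin_num.
  by apply: eq_integral => t _; rewrite gee0_abs // lee_fin -expr2 sqr_ge0.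
have /(ae_eq_integral_abs mu measurableT (measurable_int _ mu2)) u0 := int0.
rewrite -[u]reprK -pi_L2_0; apply/L2_piP/asboolP; rewrite subr0.
by apply: filterS u0 => t /(_ I) /= [/eqP]; rewrite mulf_eq0 orbb => /eqP.
Qed.

End L2InnerProduct.

(** * Finite-rank positive operators *)

Section FiniteRankOperators.
Context d (T : measurableType d) (R : realType).
Variable mu : {measure set T -> \bar R}.
Local Notation dot := (@L2_dot d T R mu).
Variables (n : nat) (h : 'I_n -> L2 mu).

(** The analysis and synthesis operators of frame theory. They are adjoint to
    each other; composed in one order they give a positive operator of finite
    rank, in the other order the Gram matrix. *)
Definition analysis (u : L2 mu) : 'cV[R]_n := \col_i dot (h i) u.

Definition synthesis (c : 'cV[R]_n) : L2 mu := \sum_i c i 0 *: h i.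

Definition gram : 'M[R]_n := \matrix_(i, j) dot (h i) (h j).

Lemma analysis_is_linear : linear analysis.
Proof. by move=> a u v; apply/matrixP => i j; rewrite !mxE L2_dotDr L2_dotZr. Qed.

HB.instance Definition _ := GRing.isLinear.Build R (L2 mu) 'cV[R]_n _ analysis
  analysis_is_linear.

Lemma synthesis_is_linear : linear synthesis.
Proof.
move=> a c e; rewrite /synthesis scaler_sumr -big_split; apply: eq_bigr => i _.
by rewrite !mxE scalerDl scalerA.
Qed.

HB.instance Definition _ := GRing.isLinear.Build R 'cV[R]_n (L2 mu) _ synthesis
  synthesis_is_linear.

Lemma dot_synthesis c u : dot (synthesis c) u = dot2 c (analysis u).
Proof.
by rewrite L2_dot_suml; apply: eq_bigr => i _; rewrite L2_dotZl mxE.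
Qed.

Lemma analysis_synthesis c : analysis (synthesis c) = gram *m c.
Proof.
apply/matrixP => i j; rewrite ord1 !mxE L2_dotC dot_synthesis.
by apply: eq_bigr => k _; rewrite !mxE mulrC L2_dotC.
Qed.

Lemma gram_sym : gram^T = gram.
Proof. by apply/matrixP => i j; rewrite !mxE L2_dotC. Qed.

Lemma gram_psd c : 0 <= dot2 c (gram *m c).
Proof. by rewrite -analysis_synthesis -dot_synthesis L2_dot_ge0. Qed.

Lemma synthesis_eq0 c : gram *m c = 0 -> synthesis c = 0.
Proof.
move=> c0; apply: L2_dot_eq0; rewrite dot_synthesis analysis_synthesis c0.
by rewrite dot20r.
Qed.

(** The coefficients [c] solve the normal equations [gram *m c = analysis u];
    they are solvable because a vector [z] with [gram *m z = 0] is orthogonal to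
    [analysis u]: its image [synthesis z] under the adjoint is zero. *)
Lemma orthogonal_projection u : exists c, analysis (u - synthesis c) = 0.
Proof.
have [MXM _ MXt _] := mp_invP gram.
pose P := gram *m mp_inv gram; pose z := analysis u - P *m analysis u.
exists (mp_inv gram *m analysis u); rewrite linearB /= analysis_synthesis mulmxA.
rewrite -/P -/z; apply: dot2_eq0.
have gP : gram *m P = gram.
  by rewrite -[LHS]trmxK trmx_mul MXt gram_sym MXM gram_sym.
have gz : gram *m z = 0 by rewrite /z mulmxBr mulmxA gP subrr.
have Pt : P^T = P by exact: MXt.
have Pz : P *m z = 0 by rewrite -Pt trmx_mul gram_sym -mulmxA gz mulmx0.
have -> : dot2 z z = dot2 z (analysis u) - dot2 z (P *m analysis u).
  by rewrite -dot2Br.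
rewrite -dot_synthesis synthesis_eq0 // L2_dot0l sub0r.
by rewrite dot2C dot2_mulmx Pt Pz dot20r oppr0.
Qed.

Variable a : R.
Hypothesis a_gt0 : 0 < a.

Let L u := a *: synthesis (analysis u).

(** With [r] the power [-1/2] of the Gram matrix, [synthesis r analysis] squares
    to [synthesis (r gram r) analysis], and [r gram r] is the identity up to
    vectors in the kernel of the Gram matrix, which [synthesis] sends to zero. *)
Lemma finite_rank_sqrt_exists : exists A, is_positive_sqrt L A.
Proof.
have [r [rsym rg rpsd rrgg]] := psd_inv_sqrt gram_sym gram_psd.
exists (fun u => Num.sqrt a *: synthesis (r *m analysis u)); split.
- by move=> b u v; rewrite !linearP.
- move=> u v; rewrite L2_dotZl L2_dotZr [dot u _]L2_dotC !dot_synthesis.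
  by rewrite dot2_mulmx rsym dot2C.
- move=> u; rewrite L2_dotZl mulr_ge0 ?sqrtr_ge0 //.
  by rewrite dot_synthesis dot2C rpsd.
- move=> u; rewrite linearZ /= analysis_synthesis -!scalemxAr linearZ /= scalerA.
  rewrite -expr2 sqr_sqrtr ?ltW //; congr (_ *: _).
  apply/eqP; rewrite -subr_eq0 -linearB; apply/eqP/synthesis_eq0.
  have grgr : gram *m r *m gram *m r = gram.
    by rewrite -rg -!mulmxA -rg (mulmxA gram r) -rg !mulmxA.
  by rewrite mulmxBr !mulmxA grgr subrr.
Qed.

End FiniteRankOperators.

(** * The range of the square root as a Hilbert space *)

Section SquareRootSpace.
Context d (T : measurableType d) (R : realType).
Variable mu : {measure set T -> \bar R}.
Local Notation dot := (@L2_dot d T R mu).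
Variables (n : nat) (h : 'I_n -> L2 mu) (a : R) (L : L2 mu -> L2 mu).
Hypothesis a_gt0 : 0 < a.
Hypothesis LE : forall u, L u = a *: synthesis h (analysis h u).

Local Notation A := (op_sqrt L).

Definition rkhs_dot (phi psi : L2 mu) : R :=
  dot (op_inv_sqrt L phi) (op_inv_sqrt L psi).

Lemma op_sqrtP : is_positive_sqrt L A.
Proof.
apply: xgetPex; have [B BP] := finite_rank_sqrt_exists h a_gt0; exists B.
by have -> : L = fun u => a *: synthesis h (analysis h u) by exact/funext.
Qed.

Lemma op_sqrt_dotC u v : dot (A u) v = dot u (A v).
Proof. by have [_ + _ _] := op_sqrtP; apply. Qed.

Lemma op_sqrtK u : A (A u) = L u.
Proof. by have [_ _ _] := op_sqrtP. Qed.

Lemma op_sqrtB u v : A (u - v) = A u - A v.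
Proof.
have [Alin _ _ _] := op_sqrtP.
by rewrite addrC -scaleN1r Alin scaleN1r addrC.
Qed.

Lemma op_sqrt0 : A 0 = 0.
Proof. by rewrite -[in LHS](subrr 0) op_sqrtB subrr. Qed.

(** The quadratic form of [L] is [<L u, u> = |A u|^2]; in particular the square
    root vanishes on the kernel of [L]. *)
Lemma op_sqrt_eq0 u : dot (L u) u = 0 -> A u = 0.
Proof. by rewrite -op_sqrtK op_sqrt_dotC => /L2_dot_eq0. Qed.

Lemma op_sqrt_orth u : L2_orth (op_kernel L) (A u).
Proof.
move=> v Lv; rewrite op_sqrt_dotC L2_dotC op_sqrt_eq0 ?L2_dot0l //.
by rewrite [L v]Lv L2_dot0l.
Qed.

Lemma op_inv_sqrtK u : L2_orth (op_kernel L) u -> op_inv_sqrt L (A u) = u.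
Proof.
move=> u_orth; rewrite /op_inv_sqrt; set D := (X in xget 0 X).
have [v_orth Av] : D (xget 0 D) by apply: xgetPex; exists u.
move: (xget 0 D) v_orth Av => v v_orth Av.
apply/eqP; rewrite -subr_eq0; apply/eqP/L2_dot_eq0.
have ker : op_kernel L (v - u)
  by rewrite /op_kernel /= -op_sqrtK op_sqrtB Av subrr op_sqrt0.
by rewrite {1}L2_dotBl v_orth // u_orth // subrr.
Qed.

(** Every element of the range of the square root has a preimage orthogonal to
    the kernel: subtract from any preimage its component in the kernel, which is
    what remains after projecting onto the span of the [h i]. *)
Lemma op_sqrt_invK phi : range A phi -> A (op_inv_sqrt L phi) = phi.
Proof.
move=> [u _ <-]; have [c uc] := orthogonal_projection h u.
have -> : A u = A (synthesis h c).
  apply/eqP; rewrite -subr_eq0 -op_sqrtB; apply/eqP/op_sqrt_eq0.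
  by rewrite LE uc linear0 scaler0 L2_dot0l.
rewrite op_inv_sqrtK // => v Lv; rewrite dot_synthesis.
have : dot (L v) v = 0 by rewrite Lv L2_dot0l.
rewrite LE L2_dotZl dot_synthesis => /eqP; rewrite mulf_eq0 gt_eqF //=.
by move=> /eqP/dot2_eq0 ->; rewrite dot20r.
Qed.

Lemma range_op u : range A (L u).
Proof. by exists (A u); rewrite // op_sqrtK. Qed.

Lemma rangeD phi psi : range A phi -> range A psi -> range A (phi + psi).
Proof.
have [Alin _ _ _] := op_sqrtP; move=> [u _ <-] [v _ <-]; exists (u + v) => //.
by rewrite -[u]scale1r Alin !scale1r.
Qed.

(** Reproducing property: the preimage of [L u = A (A u)] is [A u], and the
    remaining [A] can be moved to the preimage of [phi], which gives back [phi]. *)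
Lemma rkhs_dot_op u phi : range A phi -> rkhs_dot (L u) phi = dot u phi.
Proof.
move=> Hphi; rewrite /rkhs_dot -op_sqrtK op_inv_sqrtK; last exact: op_sqrt_orth.
by rewrite op_sqrt_dotC op_sqrt_invK.
Qed.

Lemma rkhs_dotC phi psi : rkhs_dot phi psi = rkhs_dot psi phi.
Proof. exact: L2_dotC. Qed.

(** Tested against [L u], two elements are already separated: there the inner
    product is that of [L2] with [u]. *)
Lemma rkhs_dot_inj phi psi : range A phi -> range A psi ->
  (forall u, range A u -> rkhs_dot u phi = rkhs_dot u psi) -> phi = psi.
Proof.
move=> Hphi Hpsi eq_dot; apply/eqP; rewrite -subr_eq0; apply/eqP/L2_dot_eq0.
rewrite {1}L2_dotBr -!rkhs_dot_op ?eq_dot ?subrr //; exact: range_op.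
Qed.

Local Notation basis_comb := (synthesis (fun i => L (h i))).

Definition sampling (phi : L2 mu) : 'cV[R]_n := \col_i rkhs_dot (L (h i)) phi.

Definition rkhs_gram : 'M[R]_n := \matrix_(i, j) rkhs_dot (L (h i)) (L (h j)).

Lemma basis_combE c : basis_comb c = L (synthesis h c).
Proof.
have Llin : linear L by move=> b u v; rewrite !LE !linearP.
pose L' : {linear L2 mu -> L2 mu} :=
  HB.pack L (GRing.isLinear.Build R _ _ _ L Llin).
by rewrite -[RHS]/(L' _) linear_sum; apply: eq_bigr => i _; rewrite linearZ.
Qed.

Lemma range_basis_comb c : range A (basis_comb c).
Proof. by rewrite basis_combE; exact: range_op. Qed.

Lemma samplingE phi : range A phi -> sampling phi = analysis h phi.
Proof. by move=> Hphi; apply/matrixP => i j; rewrite !mxE rkhs_dot_op. Qed.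

Lemma rkhs_dot_basis_comb c phi : range A phi ->
  rkhs_dot (basis_comb c) phi = dot2 c (sampling phi).
Proof.
by move=> Hphi; rewrite basis_combE rkhs_dot_op // dot_synthesis samplingE.
Qed.

Lemma sampling_basis_comb c : sampling (basis_comb c) = rkhs_gram *m c.
Proof.
apply/matrixP => i j; rewrite ord1 !mxE rkhs_dotC rkhs_dot_basis_comb;
  last exact: range_op.
by apply: eq_bigr => k _; rewrite !mxE mulrC rkhs_dotC.
Qed.

Lemma rkhs_gram_sym : rkhs_gram^T = rkhs_gram.
Proof. by apply/matrixP => i j; rewrite !mxE rkhs_dotC. Qed.

(** The square norm of a combination of the [L (h i)] is the quadratic
    form of their Gram matrix. *)
Lemma basis_comb_eq0 c : rkhs_gram *m c = 0 -> basis_comb c = 0.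
Proof.
move=> Gc; have Hc := range_basis_comb c.
have := rkhs_dot_basis_comb c Hc; rewrite sampling_basis_comb Gc dot20r.
move=> /L2_dot_eq0 inv0; rewrite -(op_sqrt_invK Hc) inv0.
exact: op_sqrt0.
Qed.

End SquareRootSpace.

(** * Krylov spaces and least squares *)

Section Krylov.
Variable R : realType.

Lemma lin_span_linear (U V : lmodType R) (F : {linear U -> V}) (I : finType)
    (w : I -> U) :
  F @` lin_span w = lin_span (F \o w).
Proof.
apply/seteqP; split => [_ [_ [c ->] <-]|_ [c ->]].
  by exists c; rewrite linear_sum; apply: eq_bigr => i _; rewrite linearZ.
exists (\sum_i c i *: w i); first by exists c.
by rewrite linear_sum; apply: eq_bigr => i _; rewrite linearZ.
Qed.

Lemma lin_span_mem (V : lmodType R) (I : finType) (w : I -> V) i :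
  lin_span w (w i).
Proof.
exists (fun i' => (i' == i)%:R); rewrite (bigD1 i) //= eqxx scale1r big1 ?addr0 //.
by move=> i' /negbTE ->; rewrite scale0r.
Qed.

Lemma argmin_image (U V : Type) (F : U -> V) (D : set U) (e : V -> R) :
  argmin (F @` D) e = F @` argmin D (e \o F).
Proof.
apply/seteqP; split => [_ [[u Du <-] umin]|_ [u [Du umin] <-]].
  by exists u => //; split=> // v Dv; apply: umin; exists v.
by split=> [|_ [v Dv <-]]; [exists u|exact: umin].
Qed.

(** For a symmetric matrix both products are the orthogonal projection onto the
    same space, range and row space being equal. *)
Lemma mp_inv_sym_comm n (S : 'M[R]_n) : S^T = S ->
  S *m mp_inv S = mp_inv S *m S.
Proof.
move=> Ssym; have [SXS _ SXt XSt] := mp_invP S.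
have XSS : mp_inv S *m S *m S = S.
  by apply: trmx_inj; rewrite trmx_mul XSt Ssym mulmxA.
have SSX : S *m (S *m mp_inv S) = S.
  by apply: trmx_inj; rewrite trmx_mul SXt Ssym.
by rewrite -{1}XSS -mulmxA -(mulmxA _ S) SSX.
Qed.

(** The residual has a minimizer on any finite-dimensional subspace; on one
    contained in the range of [S] it is unique, because a symmetric matrix is
    injective on its range. *)
Lemma residual_argmin n (S : 'M[R]_n) (b : 'cV[R]_n) l (z : 'I_l -> 'cV[R]_n) :
  S^T = S ->
  exists c, argmin (lin_span (fun i => S *m z i)) (fun c => norm2 (S *m c - b))
    = [set c].
Proof.
move=> Ssym; pose Z := \matrix_(p, i) z i p 0 : 'M[R]_(n, l).
have spanE : lin_span (fun i => S *m z i)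
    = range (fun a : 'cV[R]_l => S *m (Z *m a)).
  have comb (e : 'I_l -> R) : \sum_i e i *: (S *m z i) = S *m (Z *m \col_i e i).
    transitivity (S *m \sum_i e i *: z i).
      by rewrite mulmx_sumr; apply: eq_bigr => i _; rewrite scalemxAr.
    congr (_ *m _); apply/matrixP => p q; rewrite ord1 summxE mxE.
    by apply: eq_bigr => i _; rewrite !mxE mulrC.
  apply/seteqP; split => [_ [e ->]|_ [a _ <-]].
    by exists (\col_i e i); rewrite ?comb.
  exists (fun i => a i 0); rewrite comb; congr (_ *m (_ *m _)).
  by apply/matrixP => i j; rewrite !mxE ord1.
pose B := S *m (S *m Z); pose a0 := mp_inv B *m b.
have BE a : S *m (S *m (Z *m a)) = B *m a by rewrite /B !mulmxA.
exists (S *m (Z *m a0)); rewrite spanE; apply/seteqP; split.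
  move=> _ [[a _ <-] amin] /=.
  have : norm2 (S *m (S *m (Z *m a)) - b) <= norm2 (S *m (S *m (Z *m a0)) - b).
    by apply: amin; exists a0.
  rewrite !BE /norm2 ler_sqrt ?dot2_ge0 // least_squares -/a0 gerDr => le0.
  have : dot2 (B *m a - B *m a0) (B *m a - B *m a0) = 0.
    by apply/eqP; rewrite eq_le le0 dot2_ge0.
  move=> /dot2_eq0; rewrite -mulmxBr -BE -{1}Ssym => /mulmx_trmx_eq0.
  by rewrite !mulmxBr => /eqP; rewrite subr_eq0 => /eqP.
move=> _ ->; split=> [|_ [a _ <-]]; first by exists a0.
by rewrite !BE /norm2 ler_sqrt ?dot2_ge0 // [leRHS]least_squares -/a0 lerDr dot2_ge0.
Qed.

Variables (V : lmodType R) (n : nat) (S : 'M[R]_n).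
Variables (F : {linear 'cV[R]_n -> V}).
Hypothesis S_sym : S^T = S.
Hypothesis F_ker : forall c, S *m c = 0 -> F c = 0.

Lemma linear_ker_eq c e : S *m c = S *m e -> F c = F e.
Proof.
move=> Sce; apply/eqP; rewrite -subr_eq0 -linearB F_ker //.
by rewrite mulmxBr Sce subrr.
Qed.

Lemma linear_mp_proj c : F (mp_inv S *m S *m c) = F c.
Proof.
by apply: linear_ker_eq; have [SXS _ _ _] := mp_invP S; rewrite !mulmxA SXS.
Qed.

(** Raising the power by one undoes [mp_inv S] up to the kernel of [S], which
    [F] ignores. *)
Lemma linear_krylov b i :
  F (S ^+ i.+1 *m (mp_inv S *m b)) = F (S ^+ i *m b).
Proof.
apply: linear_ker_eq; have [SXS _ _ _] := mp_invP S.
have comm : S *m S ^+ i = S ^+ i *m S by rewrite -[LHS]exprS exprSr.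
rewrite !mulmxA -[S *m S ^+ i.+1]exprS exprSr exprSr -!mulmxE.
rewrite -!mulmxA (mulmxA S (mp_inv S)) mp_inv_sym_comm // (mulmxA S _ b).
rewrite (mulmxA S _ S) SXS.
by rewrite !mulmxA comm.
Qed.

(** On the image of [F] the operator [F \o top], which is the normal operator when
    [F] is the adjoint of [top], acts as [S] does on coefficients. *)
Lemma iter_normal_op (top : V -> 'cV[R]_n) b i :
  (forall c, top (F c) = S *m c) ->
  iter i (F \o top) (F b) = F (S ^+ i *m b).
Proof.
move=> topF; elim: i => [|i IH] /=; first by rewrite expr0 mul1mx.
by rewrite IH topF mulmxA -[S *m _]exprS.
Qed.

End Krylov.

(** * Measures with a density *)

Section Density.
Variable R : realType.
Local Notation leb := (@lebesgue_measure R).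
Variable w : R -> R.
Hypothesis mw : measurable_fun setT w.
Hypothesis w_ge0 : forall s, 0 <= w s.
Hypothesis w_int : leb.-integrable setT (EFin \o w).
Local Notation nu := (density_measure w).

Lemma density_measureE A : nu A = (\int[leb]_(s in A) (w s)%:E)%E.
Proof. by rewrite /density_measure; case: pselect => [?|[]]. Qed.

Lemma density_measure_fin : fin_num_fun nu.
Proof.
move=> A mA; rewrite density_measureE; apply: integrable_fin_num => //.
exact: integrableS w_int.
Qed.

Lemma density_measure_dominates : nu `<< leb.
Proof.
apply/null_content_dominatesP => A mA A0; rewrite density_measureE.
by apply: null_set_integral => //; apply/measurable_EFinP/measurable_funTS.
Qed.

(** The density is a version of the Radon-Nikodym derivative, both having the
    same integral over every measurable set. *)
Lemma Rintegral_density (F : R -> R) : nu.-integrable setT (EFin \o F) ->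
  \int[nu]_s F s = \int[leb]_s (F s * w s).
Proof.
move=> Fint; have nuT : (nu setT < +oo)%E.
  by rewrite ltey_eq density_measure_fin.
(* The same measure, with the structure of a finite measure. *)
pose nu' := mfrestr measurableT nuT.
have nu'E A : nu' A = nu A by rewrite /nu' /mfrestr /= /mrestr setIT.
have nu'_dom : nu' `<< leb.
  apply/null_content_dominatesP => A mA A0; rewrite nu'E.
  by have /null_content_dominatesP := density_measure_dominates; exact.
have Fint' : nu'.-integrable setT (EFin \o F).
  move: Fint => /integrableP[mF Fint]; apply/integrableP; split => //.
  by rewrite (eq_measure_integral nu) => // A _ _; exact: nu'E.
congr fine.
rewrite [LHS](eq_measure_integral nu') => [|A _ _]; last exact/esym/nu'E.
rewrite -(Radon_Nikodym_change_of_variables (mu := leb) (nu := nu') nu'_dom) //.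
apply: ae_eq_integral => //.
- apply: emeasurable_funM; first exact: measurable_int Fint.
  by apply: measurable_int; exact: Radon_Nikodym_integrable.
- apply/measurable_EFinP/measurable_funM => //.
  by have /measurable_EFinP := measurable_int _ Fint.
- suff : ae_eq leb setT (Radon_Nikodym (charge_of_finite_measure nu') leb)
      (EFin \o w).
    by apply: filterS => s /(_ I) ws _; rewrite EFinM ws.
  apply: integral_ae_eq => //.
  + by apply: Radon_Nikodym_integrable.
  + exact/measurable_EFinP.
  + move=> E _ mE; rewrite -Radon_Nikodym_integral // -density_measureE.
    exact: nu'E.
Qed.

End Density.

(** * Classes of square-integrable functions *)

Section L2Class.
Context d (T : measurableType d) (R : realType).
Variable mu : {measure set T -> \bar R}.
Local Open Scope quotient_scope.

Lemma bounded_Lfun2 (f : T -> R) (C : R) : (mu setT < +oo)%E ->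
  measurable_fun setT f -> (forall t, `|f t| <= C) -> f \in Lfun mu 2%:E.
Proof.
move=> mu_fin mf fC; rewrite inE; apply/andP; split; rewrite inE //=.
rewrite /finite_norm unlock poweR_lty //.
have : mu.-integrable setT (EFin \o (fun t => f t ^+ 2)).
  apply: measurable_bounded_integrable => //; first exact: measurable_funX.
  exists (C ^+ 2); split; first exact: num_real.
  move=> M CM t _ /=; rewrite (le_trans _ (ltW CM)) // normrX.
  by rewrite lerXn2r ?nnegrE ?(le_trans (normr_ge0 _) (fC t)).
move=> /integrableP[_]; apply: le_lt_trans; rewrite le_eqVlt; apply/orP; left.
by apply/eqP/eq_integral => t _ /=; rewrite powR_mulrn // normrX.
Qed.

Variables (I : finType) (F : I -> T -> R) (c : I -> R).
Hypothesis F2 : forall i, F i \in Lfun mu 2%:E.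

Let u i : LfunType mu (lee1n 2) := insubd 0 (F i).

Let sumE : (fun t => \sum_i c i * F i t) = \sum_i c i *: u i :> (T -> R).
Proof.
apply/funext => t; rewrite (big_morph (fun v : LfunType mu (lee1n 2) => v t)
  (id1 := 0) (op1 := +%R)) //.
by apply: eq_bigr => i _; rewrite /= /u /insubd insubT.
Qed.

Lemma Lfun2_sum : (fun t => \sum_i c i * F i t) \in Lfun mu 2%:E.
Proof. by rewrite sumE; exact: LfunP. Qed.

Lemma L2_class_sum :
  L2_class mu (fun t => \sum_i c i * F i t) = \sum_i c i *: L2_class mu (F i).
Proof.
rewrite sumE /L2_class [insubd _ _]valKd.
rewrite (big_morph (\pi_(L2 mu)) (id1 := 0) (op1 := +%R)).
- by apply: eq_bigr => i _; rewrite -pi_L2_scale.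
- exact: pi_L2_add.
- exact: pi_L2_0.
Qed.

End L2Class.

(** * The kernel of the data and its basis functions *)

Section Setting.
Variables (R : realType) (n0 J : nat) (x : 'I_J -> R) (g : 'I_n0 -> R -> R -> R).
Hypotheses (n0_gt0 : (0 < n0)%N) (J_gt0 : (0 < J)%N).
Hypothesis g_L2 : forall k, square_integrable_XS x (g k).
Hypothesis g_bounded : uniformly_bounded x g.
Hypothesis Z_gt0 : 0 < Znorm x g.

Local Notation leb := (@lebesgue_measure R).
Local Notation S := (`[0, 1]%classic : set R).
Local Notation rd := (rhodot x g).
Local Notation mu := (rho x g).
Local Notation dot := (@L2_dot _ _ R mu).
Local Notation bound := (n0%:R * Znorm x g * J%:R).

Lemma kjK (i : 'I_(n0 * J)) : mxvec_index (kj i).1 (kj i).2 = i.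
Proof. by case/mxvec_indexP: i => k j; rewrite mxvec_indexK. Qed.

Lemma sum_kj (V : zmodType) (F : 'I_n0 -> 'I_J -> V) :
  \sum_k \sum_j F k j = \sum_(i < n0 * J) F (kj i).1 (kj i).2.
Proof.
rewrite pair_bigA /= (reindex (@kj n0 J)) //.
exists (fun p => mxvec_index p.1 p.2) => [i _|[k j] _]; first exact: kjK.
exact: mxvec_indexK.
Qed.

(** Integrating against [rho] a function multiplied by a feature is integrating
    it against [g] for Lebesgue measure. A feature vanishes where the density
    does, division by zero being zero. *)
Definition feature (k : 'I_n0) (j : 'I_J) (s : R) : R := g k (x j) s / rd s.

Lemma n0_neq0 : n0%:R != 0 :> R.
Proof. by rewrite pnatr_eq0 -lt0n. Qed.

Lemma J_neq0 : J%:R != 0 :> R.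
Proof. by rewrite pnatr_eq0 -lt0n. Qed.

Lemma rhodot_sum s : bound * rd s = \sum_k \sum_j `|g k (x j) s|.
Proof.
rewrite /rhodot /mesh_int -mulr_sumr; move: (\sum_k _) => t.
by field; rewrite n0_neq0 J_neq0 gt_eqF.
Qed.

Lemma rhodot_ge0 s : 0 <= rd s.
Proof.
apply: mulr_ge0.
  by rewrite invr_ge0; apply: mulr_ge0; rewrite ?ler0n ?ltW.
apply: sumr_ge0 => k _; apply: mulr_ge0; first by rewrite invr_ge0 ler0n.
by apply: sumr_ge0 => j _; exact: normr_ge0.
Qed.

(** The density dominates every data function: these vanish where it does, and
    the features are bounded, hence square-integrable for [rho]. *)
Lemma norm_g_le k j s : `|g k (x j) s| <= bound * rd s.
Proof.
rewrite rhodot_sum (bigD1 k) //= (bigD1 j) //= -addrA lerDl.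
by rewrite addr_ge0 ?sumr_ge0 // => k1 _; rewrite sumr_ge0.
Qed.

Lemma featureK k j s : feature k j s * rd s = g k (x j) s.
Proof.
have [rd0|rd0] := eqVneq (rd s) 0; last by rewrite /feature divfK.
rewrite rd0 mulr0; apply/esym/eqP; rewrite -normr_le0.
by have := norm_g_le k j s; rewrite rd0 mulr0.
Qed.

Lemma bound_ge0 : 0 <= bound.
Proof. by apply: mulr_ge0; [apply: mulr_ge0; [|exact: ltW]|]; rewrite ler0n. Qed.

Lemma feature_bounded k j s : `|feature k j s| <= bound.
Proof.
have [rd0|rd0] := eqVneq (rd s) 0.
  by rewrite /feature rd0 invr0 mulr0 normr0 bound_ge0.
have rd_gt0 : 0 < rd s by rewrite lt_neqAle eq_sym rd0 rhodot_ge0.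
rewrite /feature normrM normfV (ger0_norm (rhodot_ge0 s)).
by rewrite ler_pdivrMr // norm_g_le.
Qed.

(** The mesh being finite, the kernel is an average of finitely many products of
    features; the indicator in its definition is accounted for by the vanishing
    of the features. *)
Lemma GbarE s s' : Gbar x g s s' =
  \sum_(i < n0 * J) (n0%:R * J%:R)^-1 * feature (kj i).1 (kj i).2 s
    * feature (kj i).1 (kj i).2 s'.
Proof.
have -> : Gbar x g s s' = G x g s s' / (rd s * rd s').
  rewrite /Gbar; case: ifPn => // ; rewrite lt_neqAle mulr_ge0 ?rhodot_ge0 //.
  by rewrite andbT negbK eq_sym => /eqP ->; rewrite invr0 mulr0.
rewrite -(sum_kj (fun k j => (n0%:R * J%:R)^-1 * feature k j s * feature k j s')).
rewrite /G /mesh_int -mulr_sumr mulrA -invfM mulr_sumr mulr_suml.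
apply: eq_bigr => k _; rewrite mulr_sumr mulr_suml; apply: eq_bigr => j _.
by rewrite /feature !invfM; ring.
Qed.

Lemma measurable_g k j : measurable_fun S (g k (x j)).
Proof. by have [+ _] := g_L2 k; apply. Qed.

Lemma measurable_rhodot : measurable_fun S rd.
Proof.
apply: measurable_funM => //; apply: measurable_sum => k.
apply: measurable_funM => //; apply: measurable_sum => j.
by apply: measurableT_comp => //; exact: measurable_g.
Qed.

Lemma measurable_feature k j : measurable_fun setT (feature k j \_ S).
Proof.
apply/(measurable_restrictT _ _).1 => //.
have -> : feature k j = (fun s => g k (x j) s * (rd s `^ (-1))).
  by apply/funext => s; rewrite powR_inv1 // rhodot_ge0.
apply: measurable_funM; first exact: measurable_g.
by apply: (measurableT_comp (measurable_powR _)); exact: measurable_rhodot.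
Qed.

Lemma measurable_density : measurable_fun setT (rd \_ S).
Proof. by apply/(measurable_restrictT _ _).1 => //; exact: measurable_rhodot. Qed.

Lemma density_ge0 s : 0 <= (rd \_ S) s.
Proof. by rewrite patchE; case: ifP => // _; exact: rhodot_ge0. Qed.

Lemma integrable_density : leb.-integrable setT (EFin \o (rd \_ S)).
Proof.
rewrite -restrict_EFin; apply/integrable_restrict; rewrite // setTI.
apply: measurable_bounded_integrable => //.
- by rewrite /= lebesgue_measure_itv /= lte_fin ltr01 -EFinD ltry.
- exact: measurable_rhodot.
have [C gC] := g_bounded.
exists (\sum_(k < n0) \sum_(j < J) C / bound); split; first exact: num_real.
move=> M CM s Ss /=; apply: le_trans (ltW CM).
have bound_neq0 : bound != 0.
  by apply: mulf_neq0 J_neq0; apply: mulf_neq0 n0_neq0 _; rewrite gt_eqF.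
rewrite ger0_norm ?rhodot_ge0 //.
have -> : rd s = \sum_k \sum_j `|g k (x j) s| / bound.
  rewrite -[LHS](mulKf bound_neq0) rhodot_sum mulrC mulr_suml.
  by apply: eq_bigr => k _; rewrite mulr_suml.
apply: ler_sum => k _; apply: ler_sum => j _.
by rewrite ler_wpM2r ?invr_ge0 ?bound_ge0 // gC.
Qed.

Lemma feature_Lfun2 k j : feature k j \_ S \in Lfun mu 2%:E.
Proof.
apply: (@bounded_Lfun2 _ _ _ _ _ bound).
- rewrite ltey_eq (density_measure_fin measurable_density density_ge0) //.
  exact: integrable_density.
- exact: measurable_feature.
- move=> s; rewrite patchE; case: ifP => _; first exact: feature_bounded.
  by rewrite normr0 bound_ge0.
Qed.

Definition feature_class (i : 'I_(n0 * J)) : L2 mu :=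
  class_rho x g (feature (kj i).1 (kj i).2).

Lemma restrict_sum (I : finType) (c : I -> R) (F : I -> R -> R) :
  (fun s => \sum_i c i * F i s) \_ S = (fun s => \sum_i c i * (F i \_ S) s).
Proof.
apply/funext => s; rewrite patchE; case: ifPn => sS.
  by apply: eq_bigr => i _; rewrite patchE sS.
by rewrite big1 // => i _; rewrite patchE (negbTE sS) mulr0.
Qed.

Lemma class_rho_sum (c : 'I_(n0 * J) -> R) :
  class_rho x g (fun s => \sum_i c i * feature (kj i).1 (kj i).2 s)
    = \sum_i c i *: feature_class i.
Proof.
by rewrite /class_rho restrict_sum L2_class_sum // => i; exact: feature_Lfun2.
Qed.

Lemma Gbar_Lfun2 s : Gbar x g s \_ S \in Lfun mu 2%:E.
Proof.
rewrite (_ : Gbar x g s = fun s' => \sum_(i < n0 * J)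
  (n0%:R * J%:R)^-1 * feature (kj i).1 (kj i).2 s * feature (kj i).1 (kj i).2 s').
  by rewrite restrict_sum; apply: Lfun2_sum => i; exact: feature_Lfun2.
by apply/funext => s'; exact: GbarE.
Qed.

Lemma dot_Gbar s phi : dot phi (class_rho x g (Gbar x g s)) =
  \sum_(i < n0 * J) (n0%:R * J%:R)^-1 * dot (feature_class i) phi
    * feature (kj i).1 (kj i).2 s.
Proof.
rewrite (_ : Gbar x g s = fun s' => \sum_(i < n0 * J)
  (n0%:R * J%:R)^-1 * feature (kj i).1 (kj i).2 s * feature (kj i).1 (kj i).2 s').
  rewrite class_rho_sum L2_dotC L2_dot_suml; apply: eq_bigr => i _.
  by rewrite L2_dotZl mulrAC.
by apply/funext => s'; exact: GbarE.
Qed.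

Lemma LG_dot phi : LG x g phi =
  class_rho x g (fun s => dot phi (class_rho x g (Gbar x g s))).
Proof.
congr class_rho; apply/funext => s.
rewrite L2_dot_class; last exact: Gbar_Lfun2.
rewrite Rintegral_mkcond; apply: eq_Rintegral => s' _.
by rewrite !patchE; case: ifP => // _; rewrite mulr0.
Qed.

Lemma LG_finite_rank phi : LG x g phi =
  (n0%:R * J%:R)^-1 *: synthesis feature_class (analysis feature_class phi).
Proof.
rewrite LG_dot; under eq_fun do rewrite dot_Gbar.
rewrite class_rho_sum /synthesis scaler_sumr; apply: eq_bigr => i _.
by rewrite scalerA mxE.
Qed.

(** The basis functions integrate the kernel against [g] for Lebesgue measure;
    against [rho] this amounts to replacing [g] by [g / rhodot]. *)
Lemma xi_kjE i : xi_kj x g (kj i).1 (kj i).2 = LG x g (feature_class i).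
Proof.
rewrite LG_dot; congr class_rho; apply/funext => s.
rewrite L2_dot_classes; [|exact: feature_Lfun2|exact: Gbar_Lfun2].
rewrite (Rintegral_density measurable_density density_ge0 integrable_density);
  last by apply: Lfun2_integrableM; [exact: feature_Lfun2|exact: Gbar_Lfun2].
rewrite Rintegral_mkcond; apply: eq_Rintegral => s' _.
rewrite !patchE; case: ifP => _; last by rewrite mulr0.
by rewrite mulrAC featureK mulrC.
Qed.

End Setting.

(** * Conjugate gradients in function space and in coefficients *)

Theorem theorem2p8 (R : realType) (n0 J : nat) (x : 'I_J -> R)
    (g : 'I_n0 -> R -> R -> R) (f : 'I_n0 -> R -> R) (l : nat)
    (n0_gt0 : (0 < n0)%N) (J_gt0 : (0 < J)%N)
    (mesh_x : uniform_mesh x)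
    (g_L2 : forall k, square_integrable_XS x (g k))
    (g_bounded : uniformly_bounded x g)
    (Z_gt0 : 0 < Znorm x g)
    (l_ge1 : (1 <= l)%N) :
  let b := data_vec x f in
  [/\ H0 x g `<=` HG x g,
      exists (phi_l : L2 (rho x g)) (c_l : 'cV[R]_(n0 * J)),
        [/\ argmin (Hl x g b l) (fun phi => norm2 (Top x g phi - b))
              = [set phi_l],
            argmin (Kl x g b l) (fun c => norm2 (Sigma x g *m c - b))
              = [set c_l] &
            phi_l = xi_comb x g c_l],
      Hl x g b l = xi_comb x g @` Kl x g b l
        /\ Hl x g b l
             = lin_span (fun i : 'I_l => xi_comb x g (krylov_vec x g b i.+1)),
      (forall (c : 'cV[R]_(n0 * J)) (xi' : L2 (rho x g)), H0_orth x g xi' ->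
        Top x g (xi_comb x g c + xi') = Sigma x g *m c) &
      (forall c, Top x g (xi_comb x g c) = Sigma x g *m c)
        /\ (forall c, Tadj x g c
              = xi_comb x g (mp_inv (Sigma x g) *m Sigma x g *m c))].
Proof.
move=> b.
have a_gt0 : 0 < (n0%:R * J%:R)^-1 :> R by rewrite invr_gt0 mulr_gt0 ?ltr0n.
have LE := LG_finite_rank n0_gt0 J_gt0 g_L2 g_bounded Z_gt0.
have xiE := xi_kjE n0_gt0 J_gt0 g_L2 g_bounded Z_gt0.
set h := @feature_class R n0 J x g in LE xiE; set L := LG x g in LE xiE.
set S := Sigma x g.
have TopE phi : Top x g phi = sampling h L phi.
  by apply/colP => i; rewrite [LHS]mxE [RHS]mxE xiE.
have SE : S = rkhs_gram h L.
  by apply/matrixP => i i'; rewrite [LHS]mxE [RHS]mxE !xiE.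
pose F := synthesis (fun i => L (h i)).
have FE : xi_comb x g = F.
  apply/funext => c; rewrite /xi_comb sum_kj; apply: eq_bigr => i _.
  by rewrite kjK xiE.
have HF c : HG x g (F c) by exact: (range_basis_comb a_gt0 LE).
have TF c : Top x g (F c) = S *m c.
  by rewrite TopE SE (sampling_basis_comb a_gt0 LE).
have Ssym : S^T = S by rewrite SE; exact: rkhs_gram_sym.
have Fker c : S *m c = 0 -> F c = 0.
  by rewrite SE; exact: (basis_comb_eq0 a_gt0 LE).
have dotF c phi : HG x g phi -> HG_dot x g phi (F c) = dot2 (Top x g phi) c.
  move=> Hphi; rewrite TopE [RHS]dot2C -[LHS]/(rkhs_dot L phi (F c)) rkhs_dotC.
  exact: (rkhs_dot_basis_comb a_gt0 LE).
have TadjE : Tadj x g = F.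
  apply/funext => c; apply: xget_unique.
    by split=> [|phi Hphi]; [exact: HF|exact/esym/dotF].
  move=> psi [Hpsi psiE]; apply: (rkhs_dot_inj a_gt0 LE Hpsi (HF c)) => phi Hphi.
  by apply: etrans (esym (psiE phi Hphi)) _; exact/esym/dotF.
have krylovE (i : nat) : F (krylov_vec x g b i.+1) = iter i (F \o Top x g) (F b).
  exact: etrans (linear_krylov Ssym Fker b i) (esym (iter_normal_op b i TF)).
have HlE : Hl x g b l = lin_span (fun i : 'I_l => F (krylov_vec x g b i.+1)).
  by rewrite /Hl TadjE; congr lin_span; apply/funext => i; rewrite krylovE.
have HlK : Hl x g b l = F @` Kl x g b l by rewrite HlE lin_span_linear.
split.
- move=> _ [c ->]; suff -> : \sum_p c p *: xi_kj x g p.1 p.2 = F (\col_i c (kj i)).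
    exact: HF.
  rewrite (eq_bigr (fun p => c (p.1, p.2) *: xi_kj x g p.1 p.2)); last by case.
  rewrite -(pair_bigA _ (fun k j => c (k, j) *: xi_kj x g k j)) sum_kj.
  by apply: eq_bigr => i _; rewrite mxE xiE -surjective_pairing.
- have [c cE] := residual_argmin b
    (fun i : 'I_l => S ^+ i *m (mp_inv S *m b)) Ssym.
  (* The exponents in [Kl] start at one, so its generators lie in the range of
     [S]. *)
  have KlE : Kl x g b l
      = lin_span (fun i : 'I_l => S *m (S ^+ i *m (mp_inv S *m b))).
    by congr lin_span; apply/funext => i; rewrite mulmxA -[S *m _]exprS.
  rewrite -KlE in cE; exists (F c), c; split; [|exact: cE|by rewrite FE].
  rewrite HlK argmin_image -[RHS]image_set1 -cE; congr (_ @` argmin _ _).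
  by apply/funext => e; rewrite /= TF.
- by rewrite FE; split; [exact: HlK|exact: HlE].
- move=> c xi' [Hxi' orth]; rewrite FE.
  have HFxi : HG x g (F c + xi') by exact: (rangeD a_gt0 LE (HF c) Hxi').
  rewrite TopE (samplingE a_gt0 LE HFxi) linearD /=.
  rewrite -(samplingE a_gt0 LE (HF c)) -(samplingE a_gt0 LE Hxi') -!TopE TF.
  have -> : Top x g xi' = 0.
    apply/colP => i; rewrite [LHS]mxE [RHS]mxE -[LHS]/(rkhs_dot L _ _) rkhs_dotC.
    apply: orth.
    exact: (lin_span_mem (fun p : 'I_n0 * 'I_J => xi_kj x g p.1 p.2) (kj i)).
  exact: addr0.
- rewrite FE; split=> c; first exact: TF.
  by rewrite TadjE; exact/esym/(linear_mp_proj Fker).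
Qed.
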